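(* Let $n\ge1$ and let $G_1,G_2$ be two weighted graphs on the $(n+3)$-gon, presented by symmetric $(n+3)\times(n+3)$ matrices. If 1. $\Gamma_{kl}(G_1)\ge\Gamma_{kl}(G_2)$ for all $1\le k\le l\le n+3$, and 2. $R_p(G_1)=R_p(G_2)$ for all $1\le p\le n+3$, then $\mathbb{I}(G_1)\le\mathbb{I}(G_2)$.
   Context: Fix an $(n+3)$-gon with vertices labeled $1,\dots,n+3$ clockwise. A segment $\{ij\}$ joins two distinct vertices; it is an edge if they are adjacent and a diagonal otherwise. A complete triangulation $T$ is a maximal set of pairwise non-crossing diagonals; $\widetilde T$ is $T$ together with all edges. $\widetilde{\mathcal{A}}_{A_n}$ is the positive space with one coordinate system $\{A_{ij}:\{ij\}\in\widetilde T\}$ (a torus) for each complete triangulation $T$, glued via the transition maps generated by the Plücker relations $A_{ik}A_{jl}=A_{ij}A_{kl}+A_{il}A_{jk}$, where $i,j,k,l$ are distinct vertices in clockwise cyclic order. $\mathbb{L}_+(\widetilde{\mathcal{A}}_{A_n})$ is the set of functions which are Laurent polynomials with non-negative integer coefficients in every such coordinate system. For $F_1,F_2\in\mathbb{L}_+$, write $F_1\ge F_2$ if $F_1-F_2\in\mathbb{L}_+$ (zero included). A weighted graph is a collection of segments of the $(n+3)$-gon with integral weights such that the weights of diagonals are non-negative (weights of edges may be any integers). It is presented by a symmetric matrix $G=(w_{ij})$ with $w_{ij}$ the weight of $\{ij\}$ for $i\ne j$ and $w_{ii}=0$. Put $\mathbb{I}(G)=\prod_{1\le i<j\le n+3}A_{ij}^{w_{ij}}$,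 and $$\Gamma_{kl}(G)=\frac12\sum_{k\le i,j\le l}w_{ij}\quad(1\le k\le l\le n+3),\qquad R_p(G)=\sum_{1\le j\le n+3}w_{pj}.$$ *)

(* Defs.v *)
From HB Require Import structures.
From mathcomp Require Import all_boot all_order all_algebra.
From mathcomp Require Import fraction mpoly zify ring.

Set Implicit Arguments.
Unset Strict Implicit.
Unset Printing Implicit Defensive.

Import Order.TTheory GRing.Theory Num.Theory.

Local Open Scope ring_scope.

(* The vertices 1, ..., N of the polygon are the elements 0, ..., N - 1 of    *)
(* 'I_N, and the segment joining i < j is the pair (i, j).                    *)
Section Polygon.
Variable N : nat.
Implicit Types (i j k l : 'I_N) (s t : 'I_N * 'I_N).
Implicit Types T : {set 'I_N * 'I_N}.

(* ordS is the cyclic successor, so that N - 1 and 0 are adjacent. *)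
Definition adjacent i j : bool := (j == ordS i) || (i == ordS j).

Definition is_edge s : bool := (s.1 < s.2)%N && adjacent s.1 s.2.

Definition is_diagonal s : bool := (s.1 < s.2)%N && ~~ adjacent s.1 s.2.

Definition crossing s t : bool :=
  [&& s.1 < t.1, t.1 < s.2 & s.2 < t.2]%N
  || [&& t.1 < s.1, s.1 < t.2 & t.2 < s.2]%N.

Definition noncrossing_diagonals T : bool :=
  [forall s in T, is_diagonal s]
  && [forall s in T, forall t in T, ~~ crossing s t].

Definition complete_triangulation T : bool := maxset noncrossing_diagonals T.

Definition with_edges T : {set 'I_N * 'I_N} := T :|: [set s | is_edge s].

Definition clockwise i j k l : bool :=
  [|| [&& i < j, j < k & k < l], [&& j < k, k < l & l < i],
      [&& k < l, l < i & i < j] | [&& l < i, i < j & j < k]]%N.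

End Polygon.

Section Charts.
Variables (N : nat) (K : fieldType) (A : 'I_N -> 'I_N -> K).
Variable T : {set 'I_N * 'I_N}.

Definition eval_coord (P : {mpoly int[#|with_edges T|]}) : K :=
  mmap intr (fun m => A (enum_val m).1 (enum_val m).2) P.

(* K is the field of rational functions, with rational coefficients, on the   *)
(* torus with coordinates A i j for (i, j) in with_edges T: the coordinates   *)
(* are algebraically independent and generate the field K.                    *)
Definition torus_chart : Prop :=
  (forall P, eval_coord P = 0 -> P = 0)
  /\ (forall f : K, exists P Q, eval_coord Q != 0
                             /\ f = eval_coord P / eval_coord Q).

Definition laurent_monomial (e : {ffun 'I_N * 'I_N -> int}) : K :=
  \prod_(s in with_edges T) A s.1 s.2 ^ e s.

Definition positive_laurent (f : K) : Prop :=
  exists E : seq (nat * {ffun 'I_N * 'I_N -> int}),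
    f = \sum_(t <- E) t.1%:R * laurent_monomial t.2.

End Charts.

(* The space glued from the tori of all complete triangulations of the        *)
(* (n+3)-gon along birational transition maps, described through its field of *)
(* rational functions: each torus has all of this field as its own function   *)
(* field, and the transition maps express that the A i j are functions on the *)
(* whole space subject to the Pluecker relations. This determines the field   *)
(* and the A i j, i != j, up to unique isomorphism (A i i is irrelevant);     *)
(* a_space_exists below shows that they exist.                                *)
Record a_space (n : nat) := ASpace {
  rational_function :> fieldType;
  coord : 'I_n.+3 -> 'I_n.+3 -> rational_function;
  coordC : forall i j, coord i j = coord j i;
  coord_plucker : forall i j k l, clockwise i j k l ->
    coord i k * coord j l = coord i j * coord k l + coord i l * coord j k;
  coord_chart : forall T, complete_triangulation T -> torus_chart coord T
}.

Definition Lplus n (X : a_space n) (f : X) : Prop :=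
  forall T, complete_triangulation T -> positive_laurent (@coord n X) T f.

(* A relation on the set Lplus, hence the first two conditions. *)
Definition Lplus_le n (X : a_space n) (f1 f2 : X) : Prop :=
  [/\ Lplus f1, Lplus f2 & Lplus (f2 - f1)].

Section WeightedGraphs.
Variable n : nat.
Implicit Types (G : 'M[int]_n.+3) (k l p : 'I_n.+3).

Definition weighted_graph G : Prop :=
  [/\ forall i j, G i j = G j i,
      forall i, G i i = 0
    & forall i j, is_diagonal (i, j) -> 0 <= G i j].

Definition graph_function (X : a_space n) G : X :=
  \prod_(i < n.+3) \prod_(j < n.+3 | (i < j)%N) coord X i j ^ G i j.

Definition Gamma k l G : rat :=
  2^-1 * (\sum_(i < n.+3 | (k <= i <= l)%N)
            \sum_(j < n.+3 | (k <= j <= l)%N) G i j)%:~R.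

Definition row_weight p G : int := \sum_(j < n.+3) G p j.

End WeightedGraphs.

(* Existence of the space. In with_edges T, every segment (i, j) with          *)
(* i + 1 < j is the long side of a triangle of segments i < k < j; hence      *)
(* vectors in the plane can be prescribed, and are rationally determined, by  *)
(* their determinants over with_edges T, and the maximal minors of a generic  *)
(* 2 x (n + 3) matrix are the required functions A i j.                       *)
Section Triangles.
Variables (n : nat) (T : {set 'I_n.+3 * 'I_n.+3}).
Hypothesis triT : complete_triangulation T.
Implicit Types (i j k : 'I_n.+3) (s t : 'I_n.+3 * 'I_n.+3).

Lemma adjacentE i j : (i < j)%N ->
  adjacent i j = ((j == i.+1 :> nat) || (i == 0%N :> nat) && (j == n.+2 :> nat)).
Proof.
move=> ij; rewrite /adjacent -!val_eqE /=.
have [hi hj] := (ltn_ord i, ltn_ord j).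
rewrite (modn_small (m := i.+1)); last by lia.
have [jn|jn] := eqVneq (nat_of_ord j) n.+2.
  by rewrite jn modnn eq_sym andbT.
by rewrite modn_small //; lia.
Qed.

Lemma with_edges_lt s : s \in with_edges T -> (s.1 < s.2)%N.
Proof.
have /andP[/forall_inP dT _] := maxsetp triT.
by rewrite !inE => /orP[/dT|] /andP[].
Qed.

Lemma edge_crossing s t : is_edge s -> (t.1 < t.2)%N -> ~~ crossing s t.
Proof.
case/andP=> s12; rewrite adjacentE // /crossing => es t12.
have := ltn_ord t.1; have := ltn_ord t.2; lia.
Qed.

Lemma crossingC s t : crossing (N := n.+3) s t = crossing t s.
Proof. by rewrite /crossing orbC. Qed.

Lemma with_edges_crossing s t :
  s \in with_edges T -> t \in with_edges T -> ~~ crossing s t.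
Proof.
move=> sT tT; move: (with_edges_lt sT) (with_edges_lt tT) => s12 t12.
move: sT tT; rewrite !inE => /orP[sT|es]; last by move=> _; apply: edge_crossing.
case/orP=> [tT|et]; last by rewrite crossingC; apply: edge_crossing.
have /andP[_ /forall_inP cT] := maxsetp triT.
by have /forall_inP := cT _ sT; apply.
Qed.

Lemma crossing_irr s : ~~ crossing (N := n.+3) s s.
Proof. rewrite /crossing; lia. Qed.

Lemma with_edges_max s : (s.1 < s.2)%N -> s \notin with_edges T ->
  exists2 t, t \in T & crossing s t.
Proof.
move=> s12; rewrite !inE negb_or => /andP[sT nes].
have ds : is_diagonal s by move: nes; rewrite /is_diagonal /is_edge s12.
have /andP[/forall_inP dT /forall_inP cT] := maxsetp triT.
have [/exists_inP[t tT st]|/exists_inPn H] := boolP [exists t in T, crossing s t].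
  by exists t.
suff E : s |: T = T by rewrite -E setU11 in sT.
apply: (maxsetsup triT); last exact: subsetUr.
apply/andP; split; apply/forall_inP => t; rewrite !inE.
  by case/orP=> [/eqP->|/dT].
case/orP=> [/eqP->|tT]; apply/forall_inP => u; rewrite !inE.
  by case/orP=> [/eqP->|/H//]; apply: crossing_irr.
case/orP=> [/eqP->|uT]; first by rewrite crossingC H.
by have /forall_inP := cT _ tT; apply.
Qed.

Lemma side_with_edges : (ord0, ord_max) \in with_edges T.
Proof. by rewrite !inE /is_edge adjacentE //= eqxx orbT. Qed.

Lemma with_edges_triangle i j : (i, j) \in with_edges T -> (i.+1 < j)%N ->
  exists k, [/\ (i < k < j)%N, (i, k) \in with_edges T
              & (k, j) \in with_edges T].
Proof.
move=> ijT ij; have jn := ltn_ord j.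
pose P k := (i < k < j)%N && ((i, k) \in with_edges T).
have Pi : P (inord i.+1).
  rewrite /P !inE /is_edge inordK /=; last by lia.
  by rewrite adjacentE inordK ?eqxx ?ltnSn ?orbT ?ij //; lia.
case: (arg_maxnP (fun k : 'I__ => nat_of_ord k) Pi) => k /andP[ikj ikT] kmax.
exists k; split=> //; apply/negPn/negP => kjT.
have kj : ((k, j).1 < (k, j).2)%N by rewrite /=; lia.
have [[p q] pqT C] := with_edges_max kj kjT.
have {}pqT : (p, q) \in with_edges T by rewrite inE pqT.
have := with_edges_lt pqT => /= pq.
have := with_edges_crossing ijT pqT; have := with_edges_crossing ikT pqT.
move: C; rewrite /crossing /=.
have [pi|pi] := eqVneq p i; last first.
  by move: pi; rewrite -val_eqE /= => pi; have := ltn_ord q; lia.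
rewrite {p}pi in pqT pq *; move=> C1 C2 C3.
have /kmax : P q by rewrite /P pqT andbT; lia.
by lia.
Qed.

Lemma with_edges_split i j k s :
  (i < k < j)%N -> (i, k) \in with_edges T -> (k, j) \in with_edges T ->
  s \in with_edges T -> (i <= s.1)%N -> (s.2 <= j)%N -> s != (i, j) ->
  (s.2 <= k)%N || (k <= s.1)%N.
Proof.
move=> ikj ikT kjT sT si sj; have := with_edges_lt sT.
have := with_edges_crossing ikT sT; have := with_edges_crossing kjT sT.
case: s {sT} si sj => p q /=; rewrite /crossing xpair_eqE -!val_eqE /=; lia.
Qed.

Definition det2 (F : comNzRingType) (v w : F * F) : F := v.1 * w.2 - v.2 * w.1.

Lemma vectors_exist (F : fieldType) (c : 'I_n.+3 * 'I_n.+3 -> F) :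
    {in with_edges T, forall s, c s != 0} ->
  forall d i j vi vj, (j - i <= d)%N -> (i, j) \in with_edges T ->
    det2 vi vj = c (i, j) ->
  exists v : 'I_n.+3 -> F * F, [/\ v i = vi, v j = vj &
    {in with_edges T, forall s, (i <= s.1)%N -> (s.2 <= j)%N ->
       det2 (v s.1) (v s.2) = c s}].
Proof.
move=> c0; elim=> [|d IH] i j vi vj ijd ijT vij.
  by have := with_edges_lt ijT => /=; lia.
have ij := with_edges_lt ijT; rewrite /= in ij.
have [ij1|ij1] := eqVneq (j : nat) i.+1.
  exists (fun p => if p == i then vi else vj); split.
  - by rewrite eqxx.
  - by case: eqP => // E; rewrite E ltnn in ij.
  - move=> [p q] /= pqT ip qj; have /= pq := with_edges_lt pqT.
    have Ep : p = i by apply: val_inj => /=; lia.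
    have Eq : q = j by apply: val_inj => /=; lia.
    rewrite Ep Eq eqxx; case: eqP => // E; by rewrite E ltnn in ij.
have [|k [ikj ikT kjT]] := with_edges_triangle ijT; first by lia.
have cij := c0 _ ijT.
pose vk := ((c (k, j) * vi.1 + c (i, k) * vj.1) / c (i, j),
            (c (k, j) * vi.2 + c (i, k) * vj.2) / c (i, j)).
have [|| v [vi' vk' Hv]] := IH i k vi vk _ ikT.
- by lia.
- transitivity (c (i, k) * det2 vi vj / c (i, j)); last by rewrite vij mulfK.
  by rewrite /det2 /=; field.
have [|| w [wk' wj' Hw]] := IH k j vk vj _ kjT.
- by lia.
- transitivity (c (k, j) * det2 vi vj / c (i, j)); last by rewrite vij mulfK.
  by rewrite /det2 /=; field.
exists (fun p : 'I_n.+3 => if (p <= k)%N then v p else w p); split.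
- by rewrite ifT //; lia.
- by rewrite ifF //; lia.
move=> s sT si sj; have [->|sij] := eqVneq s (i, j).
  by rewrite /= ifT ?ifF ?vi' ?wj' //; lia.
have s12 := with_edges_lt sT.
have /orP[sk|ks] := with_edges_split ikj ikT kjT sT si sj sij.
  by rewrite sk ifT ?Hv //; lia.
rewrite (leqNgt s.2) (leq_ltn_trans ks s12) /=.
have [s1k|s1k] := leqP s.1 k; last by rewrite /= Hw.
have E : s.1 = k by apply/val_inj/anti_leq; rewrite s1k ks.
by rewrite E vk' -wk' -E Hw.
Qed.

Lemma vectors_generated (K : fieldType) (S : K -> Prop)
    (v : 'I_n.+3 -> K * K) :
    (forall x y, S x -> S y -> S (x + y)) ->
    (forall x y, S x -> S y -> S (x * y)) ->
    (forall x, S x -> S x^-1) ->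
    {in with_edges T, forall s, S (det2 (v s.1) (v s.2))} ->
    {in with_edges T, forall s, det2 (v s.1) (v s.2) != 0} ->
  forall d i j, (j - i <= d)%N -> (i, j) \in with_edges T ->
    S (v i).1 -> S (v i).2 -> S (v j).1 -> S (v j).2 ->
  forall p : 'I_n.+3, (i <= p <= j)%N -> S (v p).1 /\ S (v p).2.
Proof.
move=> SD SM SV Sv v0; elim=> [|d IH] i j ijd ijT Si1 Si2 Sj1 Sj2 p ipj.
  by have := with_edges_lt ijT => /=; lia.
have ij := with_edges_lt ijT; rewrite /= in ij.
have [ij1|ij1] := eqVneq (j : nat) i.+1.
  have [pi|pi] := eqVneq (p : nat) i.
    by rewrite (val_inj pi : p = i).
  by have -> : p = j by apply: val_inj => /=; lia.
have [|k [ikj ikT kjT]] := with_edges_triangle ijT; first by lia.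
have /= dij := v0 _ ijT.
have E1 : (v k).1 = (det2 (v k) (v j) * (v i).1 + det2 (v i) (v k) * (v j).1)
                    * (det2 (v i) (v j))^-1.
  by move: dij; rewrite /det2 => dij; field.
have E2 : (v k).2 = (det2 (v k) (v j) * (v i).2 + det2 (v i) (v k) * (v j).2)
                    * (det2 (v i) (v j))^-1.
  by move: dij; rewrite /det2 => dij; field.
have Sk1 : S (v k).1.
  by rewrite E1; apply: (SM); [apply: (SD); apply: (SM)|apply: (SV)] => //;
     [exact: (Sv _ kjT)|exact: (Sv _ ikT)|exact: (Sv _ ijT)].
have Sk2 : S (v k).2.
  by rewrite E2; apply: (SM); [apply: (SD); apply: (SM)|apply: (SV)] => //;
     [exact: (Sv _ kjT)|exact: (Sv _ ikT)|exact: (Sv _ ijT)].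
have [pk|kp] := leqP p k.
  by apply: (IH i k) => //; lia.
by apply: (IH k j) => //; lia.
Qed.

End Triangles.

Lemma rmorph_mmap (R S : comNzRingType) (f : {rmorphism R -> S}) m
    (h : 'I_m -> R) (P : {mpoly int[m]}) :
  f (mmap intr h P) = mmap intr (fun i => f (h i)) P.
Proof.
rewrite /mmap rmorph_sum; apply: eq_bigr => e _.
rewrite rmorphM rmorph_int /mmap1 rmorph_prod.
by congr (_ * _); apply: eq_bigr => i _; rewrite rmorphXn.
Qed.

Lemma mmap_id m (P : {mpoly int[m]}) : mmap intr (fun i => 'X_i) P = P.
Proof.
rewrite [RHS]mpolyE; apply: eq_bigr => e _.
by rewrite mmap1_id -mul_mpolyC -[in RHS](intz P@_e) rmorph_int.
Qed.

Lemma mpolyX_neq0 m (i : 'I_m) : 'X_i != 0 :> {mpoly int[m]}.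
Proof. by rewrite -msupp_eq0 msuppX. Qed.

Lemma fraction_exists (R : idomainType) (z : {fraction R}) :
  exists a b : R, b != 0 /\ z = FracField.tofrac a / FracField.tofrac b.
Proof.
elim/quotW: z => z; exists \n_z, \d_z; split; first exact: denom_ratioP.
apply: (canRL (mulfK _)); first by rewrite tofrac_eq0 denom_ratioP.
unlock FracField.tofrac; rewrite -[LHS]FracField.pi_mul.
apply/eqmodP => /=; rewrite FracField.equivfE /FracField.mulf /=.
by rewrite !numden_Ratio ?mulf_neq0 ?oner_eq0 ?denom_ratioP // !mulr1 mulrC.
Qed.

Section Ratios.
Variables (R : comNzRingType) (K : fieldType) (e : {rmorphism R -> K}).

Definition is_ratio (f : K) : Prop := exists P Q, e Q != 0 /\ f = e P / e Q.

Lemma is_ratio_morph P : is_ratio (e P).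
Proof. by exists P, 1; rewrite rmorph1 oner_eq0 divr1. Qed.

Lemma is_ratioM x y : is_ratio x -> is_ratio y -> is_ratio (x * y).
Proof.
move=> [P [Q [Q0 ->]]] [P' [Q' [Q'0 ->]]]; exists (P * P'), (Q * Q').
by rewrite !rmorphM mulf_neq0 // mulf_div.
Qed.

Lemma is_ratioD x y : is_ratio x -> is_ratio y -> is_ratio (x + y).
Proof.
move=> [P [Q [Q0 ->]]] [P' [Q' [Q'0 ->]]].
exists (P * Q' + P' * Q), (Q * Q').
by rewrite rmorphD !rmorphM mulf_neq0 // addf_div.
Qed.

Lemma is_ratioV x : is_ratio x -> is_ratio x^-1.
Proof.
move=> [P [Q [Q0 ->]]]; have [P0|P0] := eqVneq (e P) 0.
  by rewrite P0 mul0r invr0 -(rmorph0 e); apply: is_ratio_morph.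
by exists Q, P; rewrite invf_div.
Qed.

End Ratios.

Section Existence.
Variable n : nat.
Let R := {mpoly int[n.+2 + n.+1]}.
Let K : fieldType := {fraction R}.
Let frac : {rmorphism R -> K} := @FracField.tofrac R.

(* n + 3 generic vectors in the plane, normalized by the action of SL_2 *)
Definition generic_vector (p : 'I_n.+3) : R * R :=
  (if p == ord0 then 1 else if p == ord_max then 0
   else 'X_(rshift n.+2 (inord p.-1)),
   if p == ord0 then 0 else 'X_(lshift n.+1 (inord p.-1))).

Let g := generic_vector.

Let A0 (p q : 'I_n.+3) : R :=
  if (p < q)%N then det2 (g p) (g q) else det2 (g q) (g p).

Definition generic_coord p q : K := frac (A0 p q).

Let A := generic_coord.

Let A0C p q : A0 p q = A0 q p.
Proof.
by rewrite /A0; case: ltngtP => // E; rewrite (val_inj E : p = q).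
Qed.

Lemma generic_coordC p q : A p q = A q p.
Proof. by rewrite /A /generic_coord A0C. Qed.

Lemma det2_plucker (u v w x : R * R) :
  det2 u w * det2 v x = det2 u v * det2 w x + det2 u x * det2 v w.
Proof. by rewrite /det2; ring. Qed.

Let A0_plucker (i j k l : 'I_n.+3) : (i < j)%N -> (j < k)%N -> (k < l)%N ->
  A0 i k * A0 j l = A0 i j * A0 k l + A0 i l * A0 j k.
Proof.
move=> ij jk kl; have ik := ltn_trans ij jk; have jl := ltn_trans jk kl.
by rewrite /A0 ij jk kl ik jl (ltn_trans ik kl) det2_plucker.
Qed.

Let A_plucker (i j k l : 'I_n.+3) : (i < j)%N -> (j < k)%N -> (k < l)%N ->
  A i k * A j l = A i j * A k l + A i l * A j k.
Proof.
move=> ij jk kl; rewrite /A /generic_coord -[LHS](rmorphM frac).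
rewrite -[X in X + _](rmorphM frac) -[X in _ + X](rmorphM frac).
rewrite -[RHS](rmorphD frac); congr (frac _); exact: A0_plucker.
Qed.

Lemma generic_plucker i j k l : clockwise i j k l ->
  A i k * A j l = A i j * A k l + A i l * A j k.
Proof.
case/or4P => /and3P[H1 H2 H3]; have := A_plucker H1 H2 H3.
- by [].
- rewrite (generic_coordC k i) (generic_coordC l i) (generic_coordC j i) => E.
  rewrite [LHS]mulrC [LHS]E [LHS]addrC; congr (_ + _); exact: mulrC.
- rewrite (generic_coordC k i) (generic_coordC l j) (generic_coordC k j).
  rewrite (generic_coordC l i) => E.
  rewrite [LHS]E; congr (_ + _); exact: mulrC.
- rewrite (generic_coordC l j) (generic_coordC l i) (generic_coordC l k) => E.
  rewrite [LHS]mulrC [LHS]E [LHS]addrC; congr (_ + _); exact: mulrC.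
Qed.

Section Chart.
Variable T : {set 'I_n.+3 * 'I_n.+3}.
Hypothesis triT : complete_triangulation T.

Let side := side_with_edges triT.

Lemma generic_independent P : eval_coord A (T := T) P = 0 -> P = 0.
Proof.
pose m := #|with_edges T|.
pose fr : {rmorphism {mpoly int[m]} -> {fraction {mpoly int[m]}}} :=
  @FracField.tofrac {mpoly int[m]}.
pose c (s : 'I_n.+3 * 'I_n.+3) : {fraction {mpoly int[m]}} := fr 'X_(enum_rank_in side s).
have c0 : {in with_edges T, forall s, c s != 0}.
  by move=> s _; rewrite /c tofrac_eq0 mpolyX_neq0.
have [||w [w0 wm Hw]] := vectors_exist triT c0 (d := n.+3)
    (i := ord0) (j := ord_max) (vi := (1, 0)) (vj := (0, c (ord0, ord_max)))
    _ side.
- by rewrite /=; lia.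
- by rewrite /det2 /=; ring.
pose h (idx : 'I_(n.+2 + n.+1)) := match split idx with
  | inl a => (w (inord a.+1)).2 | inr b => (w (inord b.+1)).1 end.
pose phi : {rmorphism R -> {fraction {mpoly int[m]}}} := mmap intr h.
have phiX idx : phi 'X_idx = h idx by rewrite /phi /= mmapX mmap1U.
have phi1 p : phi (g p).1 = (w p).1.
  rewrite /g /=; have [->|p0] := eqVneq p ord0; first by rewrite rmorph1 w0.
  have [->|pm] := eqVneq p ord_max; first by rewrite rmorph0 wm.
  rewrite phiX /h; case: split_ordP => b; first by move/eqP; rewrite eq_rlshift.
  move/rshift_inj <-; congr (w _).1; apply: val_inj; move: p0 pm.
  rewrite -!val_eqE /= => p0 pm; have := ltn_ord p => pn.
  by rewrite !inordK; lia.
have phi2 p : phi (g p).2 = (w p).2.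
  rewrite /g /=; have [->|p0] := eqVneq p ord0; first by rewrite rmorph0 w0.
  rewrite phiX /h; case: split_ordP => b; last by move/eqP; rewrite eq_lrshift.
  move/lshift_inj <-; congr (w _).2; apply: val_inj; move: p0.
  rewrite -!val_eqE /= => p0; have := ltn_ord p => pn.
  by rewrite !inordK; lia.
have phiA s : s \in with_edges T -> phi (A0 s.1 s.2) = c s.
  move=> sT; rewrite /A0 (with_edges_lt triT sT) /det2.
  rewrite rmorphB !rmorphM !phi1 !phi2; apply: Hw => //=.
  exact: leq_ord.
rewrite /eval_coord -rmorph_mmap => /eqP; rewrite tofrac_eq0 => /eqP.
move/(congr1 phi); rewrite rmorph_mmap rmorph0 => H.
apply/eqP; rewrite -tofrac_eq0 -[P]mmap_id -[_ == _]/(fr _ == 0) rmorph_mmap -H.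
apply/eqP; rewrite /mmap; apply: eq_bigr => e _; congr (_ * _).
by apply: mmap1_eq => k; rewrite phiA ?enum_valP // /c enum_valK_in.
Qed.

Let ev : {rmorphism {mpoly int[#|with_edges T|]} -> K} := eval_coord A (T := T).

Let evX s : s \in with_edges T -> ev 'X_(enum_rank_in side s) = A s.1 s.2.
Proof.
by move=> sT; rewrite /ev /= /eval_coord mmapX mmap1U enum_rankK_in.
Qed.

Let S := is_ratio ev.

Lemma generic_generated (f : K) : is_ratio ev f.
Proof.
have SM := @is_ratioM _ _ ev; have SD := @is_ratioD _ _ ev.
have SV := @is_ratioV _ _ ev.
have S0 : S 0 by rewrite -(rmorph0 ev); apply: is_ratio_morph.
have S1 : S 1 by rewrite -(rmorph1 ev); apply: is_ratio_morph.
have Sz (z : int) : S z%:~R by rewrite -(rmorph_int ev); apply: is_ratio_morph.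
pose v p : K * K := (frac (g p).1, frac (g p).2).
have detv s : s \in with_edges T -> det2 (v s.1) (v s.2) = A s.1 s.2.
  move=> sT; rewrite /A /generic_coord /A0 (with_edges_lt triT sT).
  by rewrite /det2 rmorphB !rmorphM.
have Sdet : {in with_edges T, forall s, S (det2 (v s.1) (v s.2))}.
  by move=> s sT; rewrite detv // -evX //; apply: is_ratio_morph.
have det0 : {in with_edges T, forall s, det2 (v s.1) (v s.2) != 0}.
  move=> s sT; rewrite detv // -evX //; apply/eqP => /generic_independent H.
  by have := mpolyX_neq0 (enum_rank_in side s); rewrite H eqxx.
have Sv p : S (v p).1 /\ S (v p).2.
  apply: (vectors_generated triT SD SM SV Sdet det0 (d := n.+3) _ side) => //.
  - by rewrite /v /g /generic_vector /= eqxx rmorph0.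
  - have := Sdet _ side; rewrite /det2 /v /g /generic_vector /= rmorph0 rmorph1.
    by rewrite mul0r subr0 mul1r.
  - exact: leq_ord.
have SX idx : S (frac 'X_idx).
  case: (split_ordP idx) => a ->.
    have [_] := Sv (lift ord0 a); rewrite /v /g /generic_vector /=.
    by rewrite inord_val.
  have [+ _] := Sv (inord a.+1); rewrite /v /g /generic_vector /=.
  have an := ltn_ord a.
  rewrite ifF; last by rewrite -val_eqE /= inordK; lia.
  rewrite ifF; last by rewrite -val_eqE /= inordK; lia.
  by rewrite inordK /= ?inord_val //; lia.
have Sfrac r : S (frac r).
  rewrite -[r]mmap_id rmorph_mmap /mmap.
  apply: big_ind => //.
  move=> e _; apply: (SM); first exact: Sz.
  rewrite /mmap1; apply: big_ind => //.
  move=> i _; elim: (e i) => [|k IHk]; first by rewrite expr0; apply: S1.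
  by rewrite exprS; apply: (SM); [exact: SX|exact: IHk].
have [a [b [b0 ->]]] := fraction_exists f.
by apply: (SM); [|apply: (SV)]; apply: Sfrac.
Qed.

End Chart.

Lemma a_space_exists : inhabited (a_space n).
Proof.
constructor; apply: (ASpace generic_coordC generic_plucker) => T triT; split.
  by move=> P; apply: generic_independent.
by move=> f; apply: generic_generated.
Qed.

End Existence.

(* Main.v *)
Require Import Defs.
From HB Require Import structures.
From mathcomp Require Import all_boot all_order all_algebra.
From mathcomp Require Import mpoly zify ring.

Set Implicit Arguments.
Unset Strict Implicit.
Unset Printing Implicit Defensive.

Import Order.TTheory GRing.Theory Num.Theory.

Local Open Scope ring_scope.

(** The vertices of the polygon are met in two guises: as elements of 'I_n.+3,
    and as natural numbers read modulo n + 3, which makes going around the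
    polygon linear.  Write D = G1 - G2 and, for a set S of vertices, Q(S) for
    the sum of the entries of D over S x S, that is, twice the total weight
    inside S.

    Since the rows of D sum to 0, Q(S) = Q(S^c).  The complement of an arc of
    consecutive vertices that passes the last vertex is one that does not, so
    the hypothesis on Gamma says that Q >= 0 on all cyclic arcs: it is a
    cyclically symmetric condition.  The weights are recovered from the arcs,
    as the mixed second differences of Q in the two end points of the arc
    (arc_form_mixed).

    If Q vanishes on all arcs then G1 = G2.  Otherwise there are i, j, k, l in
    cyclic order such that {jk} and {il} weigh more in G1 than in G2 and Q > 0
    on every arc that contains j and k but neither i nor l (exchange_exists).
    Being heavier than in G2, these two segments can be removed once from G1
    and leave a weighted graph B.  The Pluecker relation, multiplied by I(B),
    reads
        I(B + ik + jl) = I(G1) + I(B + ij + kl),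
    so G1' = B + ik + jl satisfies I(G1) <= I(G1').  Passing from G1 to G1'
    keeps the row sums and lowers Q by 2 exactly on the arcs that separate
    {j, k} from {i, l}, where Q, being even, is at least 2
    (arc_form_exchange).  Hence G1' and G2 still satisfy the hypotheses, the
    sum of Q over the arcs has dropped, and induction gives I(G1') <= I(G2).

    The search for i, j, k, l starts from an arc with Q > 0 and shrinks it to
    one whose end points j, k satisfy D j k > 0 (positive_chord).  It then
    lets the arc grow at both ends; as Q vanishes on the whole polygon, the
    growth is bounded, and positive_corner finds a stage at which Q is still
    positive on all arcs in between and the mixed difference, hence D i l, is
    positive.

    That I(G) lies in L_+ at all is the Laurent positivity of the coordinates
    (coord_laurent_lt): the Pluecker relation for {ij} and a diagonal of the
    triangulation crossing it expresses A_ij through segments that cross fewer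
    diagonals. *)

(* not the coordinates of a vector in a basis, which bear the same name *)
Local Notation coord := Defs.coord.

Definition segment n (i j : 'I_n.+3) : 'M[int]_n.+3 :=
  delta_mx i j + delta_mx j i.

(** * Positive Laurent polynomials in one chart *)

Section PositiveLaurent.
Variables (N : nat) (K : fieldType) (A : 'I_N -> 'I_N -> K).
Variable T : {set 'I_N * 'I_N}.
Hypothesis A_neq0 : {in with_edges T, forall s, A s.1 s.2 != 0}.

Lemma positive_laurent0 : positive_laurent A T 0.
Proof. by exists [::]; rewrite big_nil. Qed.

Lemma positive_laurentD f g :
  positive_laurent A T f -> positive_laurent A T g ->
  positive_laurent A T (f + g).
Proof. by move=> [E ->] [E' ->]; exists (E ++ E'); rewrite big_cat. Qed.

Lemma positive_laurent_monomial e : positive_laurent A T (laurent_monomial A T e).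
Proof. by exists [:: (1%N, e)]; rewrite big_seq1 mul1r. Qed.

Lemma laurent_monomialD (e e' : {ffun 'I_N * 'I_N -> int}) :
  laurent_monomial A T [ffun s => e s + e' s] =
  laurent_monomial A T e * laurent_monomial A T e'.
Proof.
rewrite /laurent_monomial -big_split; apply: eq_bigr => s sT /=.
by rewrite ffunE expfzDr // A_neq0.
Qed.

Lemma positive_laurentM f g :
  positive_laurent A T f -> positive_laurent A T g ->
  positive_laurent A T (f * g).
Proof.
move=> [E ->] [E' ->].
pose mul2 (t t' : nat * {ffun 'I_N * 'I_N -> int}) :=
  ((t.1 * t'.1)%N, [ffun s => t.2 s + t'.2 s]).
exists [seq mul2 t t' | t <- E, t' <- E'].
rewrite big_allpairs_dep mulr_suml; apply: eq_bigr => t _.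
rewrite mulr_sumr; apply: eq_bigr => t' _.
by rewrite laurent_monomialD natrM mulrACA.
Qed.

Lemma positive_laurent_coordX s (z : int) : s \in with_edges T ->
  positive_laurent A T (A s.1 s.2 ^ z).
Proof.
move=> sT; have := positive_laurent_monomial [ffun t => if t == s then z else 0].
rewrite /laurent_monomial (bigD1 s) //= ffunE eqxx big1 ?mulr1 // => t.
by case/andP=> _ /negPf ts; rewrite ffunE ts expr0z.
Qed.

Lemma positive_laurent1 : positive_laurent A T 1.
Proof.
have := positive_laurent_monomial [ffun=> 0].
by rewrite /laurent_monomial big1 // => s _; rewrite ffunE expr0z.
Qed.

Lemma positive_laurentXn f m :
  positive_laurent A T f -> positive_laurent A T (f ^+ m).
Proof.
move=> pf; elim: m => [|m IH]; first by rewrite expr0; apply: positive_laurent1.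
by rewrite exprS; apply: positive_laurentM.
Qed.

End PositiveLaurent.

(** * Laurent positivity of the coordinates *)

Section Coordinates.
Variables (n : nat) (X : a_space n).
Implicit Types (i j : 'I_n.+3) (T : {set 'I_n.+3 * 'I_n.+3}).

(** The coordinates of a chart are algebraically independent. *)
Lemma chart_neq0 T s : complete_triangulation T -> s \in with_edges T ->
  coord X s.1 s.2 != 0.
Proof.
move=> triT sT; have [indep _] := coord_chart X triT.
apply/eqP => A0; have := mpolyX_neq0 (enum_rank_in sT s).
rewrite (indep (mpolyX _ _)) ?eqxx //.
by rewrite /eval_coord mmapX mmap1U enum_rankK_in.
Qed.

(** Induction on the number of diagonals of T that cross s.  If t is one of
    them, the four segments that join an end point of s to one of t do not
    cross t, and a diagonal of T that crosses one of them crosses s too, as it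
    cannot pass through t.  So they all cross fewer diagonals than s does. *)
Lemma coord_laurent_lt T (s : 'I_n.+3 * 'I_n.+3) :
    complete_triangulation T -> (s.1 < s.2)%N ->
  positive_laurent (@coord n X) T (coord X s.1 s.2).
Proof.
move=> triT; have nz := chart_neq0 triT.
have [m] := ubnP #|[set t in T | crossing s t]|.
elim: m s => // m IH s; rewrite ltnS => sm s12.
have [sT|sT] := boolP (s \in with_edges T).
  by rewrite -[coord _ _ _]expr1z; apply: positive_laurent_coordX.
have [t tT st] := with_edges_max triT s12 sT.
have tT' : t \in with_edges T by rewrite inE tT.
have t12 := with_edges_lt triT tT'.
have step (u : 'I_n.+3 * 'I_n.+3) : (u.1 < u.2)%N -> ~~ crossing u t ->
    (forall d : 'I_n.+3 * 'I_n.+3, (d.1 < d.2)%N -> ~~ crossing d t ->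
       crossing u d -> crossing s d) ->
    positive_laurent (@coord n X) T (coord X u.1 u.2).
  move=> u12 ut us; apply: IH => //; apply: leq_trans sm.
  apply/proper_card/properP; split; last first.
    by exists t; rewrite !inE ?tT ?st // (negPf ut).
  apply/subsetP => d; rewrite !inE => /andP[dT ud]; rewrite dT /=.
  have dT' : d \in with_edges T by rewrite inE dT.
  apply: us => //; first exact: (with_edges_lt triT dT').
  exact: (with_edges_crossing triT dT' tT').
(* s and t are {ac} and {bd}, in one order or the other *)
have [a [b [c [d [abc cd E [pab pcd pad pbc]]]]]] : exists a b c d : 'I_n.+3,
    [/\ (a < b < c)%N, (c < d)%N,
        coord X s.1 s.2 * coord X t.1 t.2 = coord X a c * coord X b d &
        [/\ positive_laurent (@coord n X) T (coord X a b),
            positive_laurent (@coord n X) T (coord X c d),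
            positive_laurent (@coord n X) T (coord X a d) &
            positive_laurent (@coord n X) T (coord X b c)]].
  case: s s12 st step {sT sm} => i j; case: t t12 {tT tT'} => p q /= pq ij st step.
  have [ip|ip] := ltnP i p.
    exists i, p, j, q; split=> //; try by move: st; rewrite /crossing /=; lia.
    split; [apply: (step (i, p)) | apply: (step (j, q)) | apply: (step (i, q))
           | apply: (step (p, j))];
      move=> /=; try (case=> d e /= de); move: st; rewrite /crossing /=; lia.
  exists p, i, q, j; split=> //; try by move: st; rewrite /crossing /=; lia.
    exact: mulrC.
  split; [apply: (step (p, i)) | apply: (step (q, j)) | apply: (step (p, j))
         | apply: (step (i, q))];
    move=> /=; try (case=> d e /= de); move: st; rewrite /crossing /=; lia.
have -> : coord X s.1 s.2 =
    (coord X a b * coord X c d + coord X a d * coord X b c) *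
      coord X t.1 t.2 ^ (-1).
  apply: (canRL (mulfK (nz _ tT'))); rewrite E; apply: coord_plucker.
  by rewrite /clockwise; lia.
apply: positive_laurentM => //; last exact: positive_laurent_coordX.
by apply: positive_laurentD; apply: positive_laurentM.
Qed.

Lemma coord_laurent T i j : complete_triangulation T -> i != j ->
  positive_laurent (@coord n X) T (coord X i j).
Proof.
move=> triT; rewrite -val_eqE /= neq_ltn => /orP[ij|ji].
  exact: (@coord_laurent_lt T (i, j)).
by rewrite coordC; apply: (@coord_laurent_lt T (j, i)).
Qed.

(** Every segment belongs to some triangulation with its edges. *)
Lemma coord_neq0 i j : i != j -> coord X i j != 0.
Proof.
wlog ij : i j / (i < j)%N => [H ij|_].
  have := ij; rewrite -val_eqE /= neq_ltn => /orP[/H->//|ji].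
  by rewrite coordC H // eq_sym.
have nc0 : noncrossing_diagonals (set0 : {set 'I_n.+3 * 'I_n.+3}).
  by apply/andP; split; apply/forall_inP => t; rewrite inE.
have [eij|eij] := boolP (is_edge (i, j)).
  have [T triT _] := maxset_exists nc0.
  by have /= := @chart_neq0 T (i, j) triT; apply; rewrite !inE eij orbT.
have nc1 : noncrossing_diagonals [set (i, j)].
  apply/andP; split; apply/forall_inP => t; rewrite inE => /eqP->.
    by move: eij; rewrite /is_edge /is_diagonal /= ij.
  by apply/forall_inP => u; rewrite inE => /eqP->; rewrite /crossing; lia.
have [T triT sT] := maxset_exists nc1.
have /= := @chart_neq0 T (i, j) triT; apply.
by rewrite inE (subsetP sT) // inE.
Qed.

Lemma Lplus0 : Lplus (0 : X).
Proof. by move=> T _; apply: positive_laurent0. Qed.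

Lemma LplusD (f g : X) : Lplus f -> Lplus g -> Lplus (f + g).
Proof.
move=> pf pg T triT.
by apply: positive_laurentD; [apply: pf | apply: pg].
Qed.

Lemma graph_function_Lplus G : weighted_graph G -> Lplus (graph_function X G).
Proof.
move=> [_ _ dG] T triT; have nz := chart_neq0 triT.
apply: big_ind => [|f g|i _]; first exact: positive_laurent1.
  exact: positive_laurentM.
apply: big_ind => [|f g|j ij]; first exact: positive_laurent1.
  exact: positive_laurentM.
have [eij|eij] := boolP (is_edge (i, j)).
  by apply: (positive_laurent_coordX _ _ (s := (i, j))); rewrite !inE eij orbT.
have /dG : is_diagonal (i, j).
  by move: eij; rewrite /is_edge /is_diagonal /= ij.
case: (G i j) => // m _; rewrite -exprnP; apply: positive_laurentXn => //.
by apply: coord_laurent => //; rewrite -val_eqE /= neq_ltn ij.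
Qed.

Lemma graph_functionD G H :
  graph_function X (G + H) = graph_function X G * graph_function X H.
Proof.
rewrite /graph_function -big_split; apply: eq_bigr => i _ /=.
rewrite -big_split; apply: eq_bigr => j ij /=.
by rewrite mxE expfzDr // coord_neq0 // -val_eqE /= neq_ltn ij.
Qed.

Lemma graph_function_segment i j : i != j ->
  graph_function X (segment i j) = coord X i j.
Proof.
wlog ij : i j / (i < j)%N => [H ij|_].
  have := ij; rewrite -val_eqE /= neq_ltn => /orP[/H->//|ji].
  by rewrite coordC /segment addrC H // eq_sym.
rewrite /graph_function (bigD1 i) //= (bigD1 j) //= !mxE !eqxx /=.
have /negPf ji : j != i by rewrite -val_eqE /= neq_ltn ij orbT.
rewrite ji andbF addr0 expr1z big1 => [|k /andP[_ /negPf kj]]; last first.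
  by rewrite !mxE eqxx kj (eq_sym i) ji andbF addr0 expr0z.
rewrite mulr1 big1 ?mulr1 // => a /negPf ai.
apply: big1 => b ab; rewrite !mxE ai /=.
case: eqP => [aj|_]; last by rewrite addr0 expr0z.
case: eqP => [bi|_]; last by rewrite addr0 expr0z.
by move: ab; rewrite aj bi; lia.
Qed.

End Coordinates.

(** * A positive mixed difference *)

(** Suppose that no corner of a rectangle of positive values at the origin has
    a positive mixed difference.  Then the differences F (p + 1) y - F p y are
    nonincreasing in y as long as [0, p] x [0, y) is such a rectangle.  Going
    through the columns p, and lowering the height q of the rectangle to the
    first zero of column p, one keeps F p q + F 0 0 <= F p 0: it holds at p = 0
    because F 0 b = 0, lowering q to a zero only decreases F p q, and the
    monotonicity carries it to p + 1.  So F p 0 > 0 for all p, against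
    F a 0 = 0. *)
Lemma positive_corner (F : nat -> nat -> int) a b :
    (forall p q, 0 <= F p q) -> 0 < F 0%N 0%N -> F a 0%N = 0 -> F 0%N b = 0 ->
  exists p q, [/\ (p < a)%N, (q < b)%N,
    forall p' q', (p' <= p)%N -> (q' <= q)%N -> 0 < F p' q' &
    0 < F p.+1 q.+1 - F p q.+1 - F p.+1 q + F p q].
Proof.
move=> F0 F00 Fa Fb.
pose good p q := [forall p' : 'I_p.+1, forall q' : 'I_q.+1, 0 < F p' q'].
pose corner p q := good p q && (0 < F p.+1 q.+1 - F p q.+1 - F p.+1 q + F p q).
have [/existsP[p /existsP[q /andP[/forallP H D]]]|nocorner] :=
    boolP [exists p : 'I_a, exists q : 'I_b, corner p q].
  exists p, q; split=> // p' q' pp' qq'.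
  by have /forallP/(_ (Ordinal (qq' : (q' < q.+1)%N))) :=
    H (Ordinal (pp' : (p' < p.+1)%N)).
suff [q [_ _ _]] : exists q, [/\ (0 < q)%N, (q <= b)%N,
    forall p' q', (p' < a)%N -> (q' < q)%N -> 0 < F p' q' &
    F a q + F 0%N 0%N <= F a 0%N] by have := F0 a q; lia.
have: (a <= a)%N by [].
elim: {1 3 4 5}a => [|p IH] pa.
  exists b; split=> //; last by rewrite Fb add0r.
  by case: b Fb {nocorner} => // Fb; move: F00; rewrite Fb ltxx.
have [q [q0 qb Fpos Fq]] := IH (ltnW pa).
(* the height at which column p first reaches 0, capped by q *)
have exz : exists z, (z == q) || (F p z == 0) by exists q; rewrite eqxx.
case: (ex_minnP exz) => z zP zmin.
have zq : (z <= q)%N by apply: zmin; rewrite eqxx.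
have z0 : (0 < z)%N.
  case: z zP {zmin zq} => // /orP[/eqP E|/eqP E]; first by rewrite -E in q0.
  by have := F0 p q; lia.
have Fp q' : (q' < z)%N -> 0 < F p q'.
  move=> q'z; rewrite lt0r F0 andbT; apply/negP => E.
  by have := zmin q'; rewrite E orbT => /(_ isT); lia.
have pos p' q' : (p' < p.+1)%N -> (q' < z)%N -> 0 < F p' q'.
  rewrite ltnS leq_eqVlt => /orP[/eqP->|p'p] q'z; first exact: Fp.
  by apply: Fpos => //; apply: leq_trans zq.
have Fz : F p z + F 0%N 0%N <= F p 0%N.
  by case/orP: zP => /eqP E; [rewrite E | have := F0 p q; lia].
exists z; split=> //; first exact: leq_trans qb.
suff: forall y, (y <= z)%N -> F p.+1 y - F p y <= F p.+1 0%N - F p 0%N.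
  by move/(_ z (leqnn z)); lia.
elim=> [//|y IHy] yz; apply: le_trans (IHy (ltnW yz)).
have yb : (y < b)%N by apply: leq_trans qb; apply: leq_trans zq.
move/existsPn/(_ (Ordinal pa))/existsPn/(_ (Ordinal yb)): nocorner.
rewrite negb_and => /orP[/negP[]|]; last by rewrite /=; lia.
apply/forallP => p'; apply/forallP => q'; apply: pos; first exact: ltn_ord.
exact: leq_trans (ltn_ord q') yz.
Qed.

(** * Arcs of the polygon *)

Section Arcs.
Variable n : nat.
Local Notation N := n.+3.

Definition vertex (t : nat) : 'I_N := Ordinal (ltn_pmod t (ltn0Sn n.+2)).

(** The indicator of the arc x, ..., y - 1 as a row vector (with multiplicities
    if y > x + N): as sums of unit vectors, arcs are easy to extend, to cut and
    to evaluate a bilinear form on. *)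
Definition arc (x y : nat) : 'rV[int]_N :=
  \sum_(x <= t < y) delta_mx 0 (vertex t).

Lemma vertexDN t : vertex (t + N) = vertex t.
Proof. by apply: val_inj; rewrite /= modnDr. Qed.

Lemma vertex_ord (i : 'I_N) : vertex i = i.
Proof. by apply: val_inj; rewrite /= modn_small. Qed.

Lemma eq_vertex i s t : (i <= t < i + N)%N -> (i <= s < i + N + N)%N ->
  (vertex s == vertex t) = (s == t) || (s == t + N)%N.
Proof.
move=> it si; apply/idP/idP => [|/orP[/eqP->//|/eqP->]]; last by rewrite vertexDN.
rewrite -val_eqE /= -/N => E.
have [st|ts] := leqP t s.
  move: E; rewrite eqn_mod_dvd // => /dvdnP[[|[|k]]]; rewrite ?mulSn; lia.
move: E; rewrite eq_sym eqn_mod_dvd // => [|]; last exact: ltnW.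
move/dvdnP=> [[|k]]; rewrite ?mulSn; lia.
Qed.

Lemma arcSr x y : (x <= y)%N -> arc x y.+1 = arc x y + delta_mx 0 (vertex y).
Proof. exact: big_nat_recr. Qed.

Lemma arcSl x y : (x < y)%N -> arc x y = delta_mx 0 (vertex x) + arc x.+1 y.
Proof. exact: big_ltn. Qed.

Lemma arc_nil x : arc x x = 0.
Proof. exact: big_geq. Qed.

Lemma arc_cat x y z : (x <= y)%N -> (y <= z)%N -> arc x z = arc x y + arc y z.
Proof. exact: big_cat_nat. Qed.

Lemma arc_shift x y : arc (x + N) (y + N) = arc x y.
Proof.
rewrite /arc big_addn addnK; apply: eq_bigr => t _.
by rewrite vertexDN.
Qed.

(** Below, arcs are normalized to start in (i, i + N]; as they have at most N
    vertices, they can reach the vertex t in [i, i + N) only as t or t + N. *)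
Lemma arc_entry i t x y : (i < x <= i + N)%N -> (x <= y <= x + N)%N ->
    (i <= t < i + N)%N ->
  arc x y 0 (vertex t) = ((x <= t < y) || (x <= t + N < y))%N%:R.
Proof.
move=> ix /andP[xy yx] it; move: yx; rewrite -(subnKC xy).
elim: (y - x)%N => [|d IH] xd.
  by rewrite addn0 arc_nil mxE; case: (boolP (_ || _)) => //; lia.
rewrite addnS arcSr ?leq_addr // 2!mxE IH; last by lia.
rewrite eqxx /= eq_sym (eq_vertex it); last by lia.
case: (boolP (_ || _)); case: (boolP (_ || _)) => /=;
  case: (boolP (_ || _)) => //=; lia.
Qed.

Lemma arc_full x : arc x (x + N) = const_mx 1.
Proof.
elim: x => [|x IH]; last first.
  have xN : (x < x + N)%N by lia.
  by rewrite -IH (arcSl xN) addSn (arcSr xN) vertexDN addrC.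
apply/rowP => a; rewrite add0n /arc big_mkord summxE mxE (bigD1 a) //=.
rewrite mxE vertex_ord !eqxx big1 ?addr0 // => t ta.
by rewrite mxE vertex_ord eq_sym (negPf ta) andbF.
Qed.

Lemma arc_linear x y (a : 'I_N) : (x <= y <= N)%N ->
  arc x y 0 a = (x <= a < y)%N%:R.
Proof.
case/andP=> xy; rewrite -(subnKC xy).
elim: (y - x)%N => [|d IH] dN.
  by rewrite addn0 arc_nil mxE; case: (boolP (_ && _)) => //; lia.
rewrite addnS arcSr ?leq_addr // 2!mxE IH; last by lia.
rewrite eqxx -val_eqE /= modn_small; last by lia.
by case: (boolP (_ && _)); case: (boolP (_ && _)); case: eqP => //=; lia.
Qed.

Lemma arc_modn x x' d : x = x' %[mod N] -> arc x (x + d) = arc x' (x' + d).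
Proof.
move=> xx'; rewrite /arc -{1}[x]add0n -{1}[x']add0n !big_addn !addKn.
apply: eq_bigr => t _; congr (delta_mx 0 _); apply: val_inj => /=.
by rewrite -modnDmr xx' modnDmr.
Qed.

Lemma modn_representative i x :
  exists x', (i < x' <= i + N)%N /\ x = x' %[mod N].
Proof.
exists (i.+1 + (x + i.+1 * N - i.+1) %% N)%N; split.
  rewrite leq_addr addSn ltn_add2l.
  by rewrite ltn_mod.
rewrite modnDmr subnKC ?modnMDr 1?addnC ?modnMDl //.
by rewrite mulnS; lia.
Qed.

Lemma vertex_neq s t : (s < t < s + N)%N -> vertex s != vertex t.
Proof. move=> st; rewrite eq_sym (@eq_vertex s); lia. Qed.

Lemma clockwise_vertex i j k l : (i < j)%N -> (j < k)%N -> (k < l)%N ->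
  (l < i + N)%N -> clockwise (vertex i) (vertex j) (vertex k) (vertex l).
Proof.
move=> ij jk kl li; rewrite /clockwise /=.
have Es s : (i <= s < i + N)%N ->
    (s %% N = if i %% N + (s - i) < N then i %% N + (s - i)
              else i %% N + (s - i) - N)%N.
  move=> si; have -> : (s %% N = (i %% N + (s - i)) %% N)%N.
    by rewrite modnDml subnKC //; lia.
  have iN : (i %% N < N)%N by rewrite ltn_mod.
  case: ifP => sN; first by rewrite modn_small.
  rewrite -{1}[(_ + _)%N](@subnK N); last by lia.
  by rewrite modnDr modn_small //; lia.
have iN : (i %% N < N)%N by rewrite ltn_mod.
rewrite (Es j) ?(Es k) ?(Es l); try lia.
by do 3 case: ifP; lia.
Qed.

(** * The quadratic form of a weighted graph on the arcs *)

Definition bform (D : 'M[int]_N) (u w : 'rV[int]_N) : int := (u *m D *m w^T) 0 0.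

Lemma bformDl D u u' w : bform D (u + u') w = bform D u w + bform D u' w.
Proof. by rewrite /bform !mulmxDl mxE. Qed.

Lemma bformDr D u w w' : bform D u (w + w') = bform D u w + bform D u w'.
Proof. by rewrite /bform linearD /= mulmxDr mxE. Qed.

Lemma bformD D D' u w : bform (D + D') u w = bform D u w + bform D' u w.
Proof. by rewrite /bform mulmxDr mulmxDl mxE. Qed.

Lemma bformN D u w : bform (- D) u w = - bform D u w.
Proof. by rewrite /bform mulmxN mulNmx mxE. Qed.

Lemma bform_delta D a b : bform D (delta_mx 0 a) (delta_mx 0 b) = D a b.
Proof. by rewrite /bform -rowE trmx_delta -colE !mxE. Qed.

Lemma bform_delta_mx i j u w : bform (delta_mx i j) u w = u 0 i * w 0 j.
Proof.
rewrite /bform -(mul_delta_mx (0 : 'I_1)) mulmxA -colE -mulmxA -rowE mxE big_ord1.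
by rewrite !mxE.
Qed.

Lemma bform_segment i j u : bform (segment i j) u u = 2 * u 0 i * u 0 j.
Proof. by rewrite bformD !bform_delta_mx; ring. Qed.

(** This is 2 Gamma for arcs that do not pass the last vertex. *)
Definition arc_form D x y : int := bform D (arc x y) (arc x y).

Section Balanced.
Variable D : 'M[int]_N.
Hypotheses (D_sym : D^T = D) (D_diag : forall a, D a a = 0).
Hypothesis D_row : forall a, \sum_b D a b = 0.
Local Notation E := (arc_form D).

Lemma bformC u w : bform D u w = bform D w u.
Proof.
transitivity ((w *m D *m u^T)^T 0 0); last by rewrite mxE.
by rewrite !trmx_mul trmxK D_sym mulmxA.
Qed.

Lemma bform1r u : bform D u (const_mx 1) = 0.
Proof.
suff E0 : D *m (const_mx 1)^T = 0 :> 'cV_N.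
  by rewrite /bform -mulmxA E0 mulmx0 mxE.
apply/colP => a; rewrite !mxE -[RHS](D_row a); apply: eq_bigr => b _.
by rewrite !mxE mulr1.
Qed.

Lemma arc_form_nil x : E x x = 0.
Proof. by rewrite /arc_form arc_nil /bform !mul0mx mxE. Qed.

Lemma arc_form1 x : E x x.+1 = 0.
Proof.
by rewrite /arc_form arcSr // arc_nil add0r bform_delta D_diag.
Qed.

(** An arc and its complement add up to the constant vector 1, which lies in
    the radical of the form. *)
Lemma arc_formC x y : (x <= y <= x + N)%N -> E x y = E y (x + N).
Proof.
case/andP=> xy yx; have U := arc_full x; rewrite (arc_cat xy yx) in U.
have := bform1r (arc x y); have := bform1r (arc y (x + N)).
rewrite -U !bformDr /arc_form (bformC (arc y _) (arc x _)); lia.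
Qed.

Lemma arc_form_full x : E x (x + N) = 0.
Proof. by rewrite -arc_formC ?arc_form_nil // leqnn leq_addr. Qed.

Lemma arc_form_full1 x y : y.+1 = (x + N)%N -> E x y = 0.
Proof. by move=> yx; rewrite arc_formC -?yx ?arc_form1 //; lia. Qed.

(** With m the arc from x + 1 to y - 1, the four arcs are m with or without its
    neighbours x and y: all terms cancel but those that pair x with y. *)
Lemma arc_form_mixed x y : (x < y)%N ->
  E x y.+1 - E x.+1 y.+1 - E x y + E x.+1 y = 2 * D (vertex x) (vertex y).
Proof.
move=> xy; rewrite /arc_form (@arcSr x y) ?(@arcSr x.+1 y) // 1?ltnW //.
rewrite (arcSl xy) !bformDl !bformDr.
rewrite (bformC (arc _ _) (delta_mx 0 (vertex x))).
rewrite (bformC (arc _ _) (delta_mx 0 (vertex y))).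
rewrite (bformC (delta_mx 0 (vertex y)) (delta_mx 0 (vertex x))).
by rewrite !bform_delta; ring.
Qed.

Lemma arc_form_even x y : (x <= y)%N -> exists m, E x y = 2 * m.
Proof.
move=> xy; rewrite -(subnKC xy).
elim: (y - x)%N => [|d [m IH]]; first by exists 0; rewrite addn0 arc_form_nil.
exists (m + bform D (arc x (x + d)) (delta_mx 0 (vertex (x + d)))).
rewrite /arc_form addnS arcSr ?leq_addr // !bformDl !bformDr.
rewrite (bformC (delta_mx _ _) (arc _ _)) bform_delta D_diag.
by rewrite -[bform _ (arc _ _) (arc _ _)]/(E _ _) IH; ring.
Qed.

Lemma arc_form_modn x x' d : x = x' %[mod N] -> E x (x + d) = E x' (x' + d).
Proof. by move=> xx'; rewrite /arc_form (arc_modn d xx'). Qed.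

(** An arc that passes the last vertex has a complement that does not. *)
Lemma arc_form_ge0 : (forall x y, (x <= y <= N)%N -> 0 <= E x y) ->
  forall x y, (x <= y <= x + N)%N -> 0 <= E x y.
Proof.
move=> E0 x y /andP[xy]; rewrite -(subnKC xy) leq_add2l.
move: (y - x)%N => d dN; have xN : (x %% N < N)%N by rewrite ltn_mod.
rewrite (@arc_form_modn x (x %% N)) ?modn_mod //.
have [yN|Ny] := leqP (x %% N + d) N; first by apply: E0; lia.
rewrite arc_formC; last by lia.
rewrite -[X in E X](@subnK N); last by lia.
rewrite /arc_form arc_shift; apply: E0; lia.
Qed.

Lemma arc_form_eq0 : (forall x y, (x <= y <= x + N)%N -> E x y = 0) -> D = 0.
Proof.
move=> E0.
have lt (a b : 'I_N) : (a < b)%N -> D a b = 0.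
  move=> ab; have := arc_form_mixed ab; rewrite !vertex_ord.
  by have := ltn_ord b=> bN; rewrite !E0; lia.
apply/matrixP => a b; rewrite [RHS]mxE.
have [ab|ba|ab] := ltngtP a b; first exact: lt.
  by rewrite -D_sym mxE lt.
by rewrite (val_inj ab) D_diag.
Qed.

Hypothesis E_ge0 : forall x y, (x <= y <= x + N)%N -> 0 <= E x y.

(** By arc_form_mixed, if the weight of the chord of an arc with E > 0 is not
    positive, then E > 0 for the arc deprived of one of its end points. *)
Lemma positive_chord d x : (d <= N)%N -> 0 < E x (x + d) ->
  exists j k, [/\ (x <= j < k)%N, (k < j + N)%N,
                  0 < E j k.+1 & 0 < D (vertex j) (vertex k)].
Proof.
elim: d x => [|[|d] IH] x dN; first by rewrite addn0 arc_form_nil ltxx.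
  by rewrite addn1 arc_form1 ltxx.
set y := (x + d.+1)%N; rewrite addnS -/y => Epos.
have xy : (x < y)%N by rewrite /y; lia.
have [Dxy|Dxy] := ltP 0 (D (vertex x) (vertex y)).
  by exists x, y; split=> //; rewrite ?leqnn //= /y; lia.
have Em := arc_form_mixed xy.
have E1 : 0 <= E x.+1 y by apply: E_ge0; rewrite /y; lia.
have [Exy|Exy] := ltP 0 (E x y); first exact: (IH x (ltnW dN)).
have [|j [k [xj kj Ejk Djk]]] := IH x.+1 (ltnW dN).
  by rewrite (_ : (x.+1 + d.+1)%N = y.+1); [lia | rewrite /y; lia].
by exists j, k; split=> //; lia.
Qed.

(** After positive_chord, apply positive_corner to the arcs that extend [j, k]
    by p vertices on the left and q on the right.  E vanishes on the arcs with
    N - 1 or N vertices, so the arcs found have at most N - 2 vertices; this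
    leaves room for the two distinct vertices i and l. *)
Lemma exchange_exists x y : (x <= y <= x + N)%N -> 0 < E x y ->
  exists i j k l, [/\ [/\ (i < j)%N, (j < k)%N, (k < l)%N & (l < i + N)%N],
    0 < D (vertex j) (vertex k), 0 < D (vertex i) (vertex l) &
    forall a b, (i < a <= j)%N -> (k < b <= l)%N -> 0 < E a b].
Proof.
move=> xyN Exy.
(* start at x + N, so that the left end point can decrease by up to N *)
have [||j [k [Nj kj Ejk Djk]]] := @positive_chord (y - x) (x + N).
- lia.
- rewrite (@arc_form_modn _ x) ?modnDr //.
  by rewrite subnKC //; lia.
(* cut off beyond the whole polygon, where E need not be nonnegative *)
pose F p q := if (k.+1 + q <= j - p + N)%N then E (j - p) (k.+1 + q) else 0.
pose a := (j + N - k.+1)%N.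
have [|||| p [q [pa qa Fpos Fcorner]]] := @positive_corner F a a.
- move=> p q; rewrite /F; case: ifP => // pq; apply: E_ge0; lia.
- rewrite /F subn0 addn0 ifT //; lia.
- rewrite /F ifT; last by rewrite /a; lia.
  by rewrite (_ : (k.+1 + 0 = j - a + N)%N) ?arc_form_full // /a; lia.
- rewrite /F ifT; last by rewrite /a; lia.
  by rewrite subn0 (_ : (k.+1 + a = j + N)%N) ?arc_form_full // /a; lia.
have := Fpos p q (leqnn _) (leqnn _); rewrite {1}/F; case: ifP => // pqN Epq.
have pq2 : (k.+1 + q + 2 <= j - p + N)%N.
  have [E0|n0] := eqVneq (k.+1 + q)%N (j - p + N)%N.
    by rewrite E0 arc_form_full ltxx in Epq.
  have [E1|n1] := eqVneq (k.+1 + q).+1 (j - p + N)%N.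
    by rewrite arc_form_full1 ?ltxx in Epq.
  by lia.
exists (j - p.+1)%N, j, k, (k.+1 + q)%N; split=> //.
- by split; lia.
- rewrite /F !ifT in Fcorner; try lia.
  have il : (j - p.+1 < k.+1 + q)%N by lia.
  have := arc_form_mixed il.
  rewrite -addnS (_ : (j - p.+1).+1 = j - p)%N; last by lia.
  by lia.
- move=> b c jb kc; have: 0 < F (j - b)%N (c - k.+1)%N by apply: Fpos; lia.
  by rewrite /F subKn ?subnKC; try lia; case: ifP.
Qed.

Section Exchange.
Variables i j k l : nat.
Hypotheses (ij : (i < j)%N) (jk : (j < k)%N) (kl : (k < l)%N).
Hypothesis li : (l < i + N)%N.
Hypothesis E_rect : forall a b, (i < a <= j)%N -> (k < b <= l)%N -> 0 < E a b.

Local Notation D' := (D + segment (vertex i) (vertex k)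
  + segment (vertex j) (vertex l) - segment (vertex i) (vertex l)
  - segment (vertex j) (vertex k)).

(** On the indicator of a set S of vertices, the product is 1 if S separates
    {j, k} from {i, l}, -1 if S separates {i, k} from {j, l}, and 0 otherwise. *)
Lemma bform_exchange u : bform D' u u = bform D u u
  - 2 * ((u 0 (vertex j) - u 0 (vertex i)) * (u 0 (vertex k) - u 0 (vertex l))).
Proof. by rewrite 4!bformD 2!bformN !bform_segment; ring. Qed.

(** An arc never separates {i, k} from {j, l}.  If it separates {j, k} from
    {i, l}, then the arc or its complement is as in E_rect, so E > 0 there,
    and E >= 2 because E is even. *)
Lemma arc_form_exchange x y : (x <= y <= x + N)%N ->
  0 <= arc_form D' x y <= E x y.
Proof.
case/andP=> xy; rewrite -(subnKC xy) leq_add2l.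
move: (y - x)%N => d {xy} dN.
have [x' [ix' xx']] := modn_representative i x.
rewrite /arc_form (arc_modn d xx') -!/(arc_form _ _ _) {x xx'}.
have x'd : (x' <= x' + d <= x' + N)%N by lia.
move: (x' + d)%N x'd => {d dN} y xy.
have -> : arc_form D' x' y = _ := bform_exchange _.
rewrite -/(arc_form _ _ _) !(arc_entry ix' xy); try lia.
have Ege0 := E_ge0 xy.
have [m Em] : exists m, E x' y = 2 * m by apply: arc_form_even; lia.
have Erect := E_rect (a := x') (b := y).
(* the complement of an arc that contains i and l but neither j nor k *)
have Erect' : (i < y - N <= j)%N -> (k < x' <= l)%N -> 0 < E x' y.
  move=> H1 H2; rewrite (arc_formC xy) -[X in E X](@subnK N); last by lia.
  by rewrite /arc_form arc_shift; apply: E_rect.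
by do 4 (case: (boolP (_ || _)) => ? /=); lia.
Qed.

Lemma arc_form_exchange_lt : arc_form D' j k.+1 < E j k.+1.
Proof.
by rewrite /arc_form bform_exchange !(@arc_entry i); lia.
Qed.

End Exchange.

End Balanced.

End Arcs.

(** * Weighted graphs and the exchange *)

Section WeightedGraphs.
Variable n : nat.
Local Notation N := n.+3.
Implicit Types (G H B : 'M[int]_N) (a b i j k l : 'I_N).

Lemma weighted_graphD G H :
  weighted_graph G -> weighted_graph H -> weighted_graph (G + H).
Proof.
move=> [Gs Gd Gp] [Hs Hd Hp]; split=> [i j|i|i j ij]; rewrite !mxE.
- by rewrite Gs Hs.
- by rewrite Gd Hd.
- by rewrite addr_ge0 ?Gp ?Hp.
Qed.

Lemma weighted_graph_segment a b : a != b -> weighted_graph (segment a b).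
Proof.
move=> /negPf ab; split=> [i j|i|i j _]; rewrite !mxE.
- by rewrite addrC andbC (andbC (_ == b)).
- have [->|_] := eqVneq i a; first by rewrite ab.
  by rewrite andbF.
- by rewrite addr_ge0.
Qed.

(** If {jk} is a diagonal, its weight in G1 exceeds a nonnegative one, so it is
    at least 1; if it is an edge, its weight may become negative.  The same
    holds for {il}. *)
Lemma weighted_graph_remove G1 G2 i j k l :
    weighted_graph G1 -> weighted_graph G2 -> uniq [:: i; j; k; l] ->
    0 < (G1 - G2) j k -> 0 < (G1 - G2) i l ->
  weighted_graph (G1 - segment i l - segment j k).
Proof.
move=> [G1s G1d G1p] [G2s G2d G2p]; rewrite /= !inE !negb_or !andbT.
case/and3P=> /and3P[/negPf nij /negPf nik /negPf nli] /andP[/negPf njk /negPf njl].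
move=> /negPf nkl; rewrite !mxE => Djk Dil; split=> [x y|x|x y xy].
- rewrite !mxE G1s ![(x == _) && _]andbC; ring.
- rewrite !mxE G1d; have [->|_] := eqVneq x i; first by rewrite nij nli nik.
  by have [->|_] := eqVneq x j; rewrite ?njl ?njk ?andbF.
have [p1 p2] := (G1p _ _ xy, G2p _ _ xy); rewrite !mxE.
have nC (u v : 'I_N) : (u == v) = false -> (v == u) = false by rewrite eq_sym.
have neqs := (nij, nik, nli, njk, njl, nkl, nC _ _ nij, nC _ _ nik, nC _ _ nli,
  nC _ _ njk, nC _ _ njl, nC _ _ nkl).
have remove1 (z w : int) : 0 <= w -> 0 < z - w -> 0 <= z - 1 by lia.
have [/andP[/eqP xi /eqP yl]|_] := boolP ((x == i) && (y == l)).
  rewrite xi yl in p2 *; rewrite !(eqxx, neqs) /= ?(addr0, add0r, subr0).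
  exact: remove1 p2 Dil.
have [/andP[/eqP xi /eqP yl]|_] := boolP ((x == l) && (y == i)).
  rewrite xi yl in p2 *; rewrite !(eqxx, neqs) /= ?(addr0, add0r, subr0).
  by rewrite G1s; rewrite G2s in p2; apply: remove1 p2 Dil.
have [/andP[/eqP xi /eqP yl]|_] := boolP ((x == j) && (y == k)).
  rewrite xi yl in p2 *; rewrite !(eqxx, neqs) /= ?(addr0, add0r, subr0).
  exact: remove1 p2 Djk.
have [/andP[/eqP xi /eqP yl]|_] := boolP ((x == k) && (y == j)).
  rewrite xi yl in p2 *; rewrite /= !(addr0, add0r, subr0).
  by rewrite G1s; rewrite G2s in p2; apply: remove1 p2 Djk.
by rewrite /= !(addr0, oppr0).
Qed.

Lemma graph_function_plucker (X : a_space n) B i j k l : clockwise i j k l ->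
    uniq [:: i; j; k; l] ->
  graph_function X (B + segment i k + segment j l) =
    graph_function X (B + segment i l + segment j k) +
    graph_function X (B + segment i j + segment k l).
Proof.
move=> ijkl; rewrite /= !inE !negb_or !andbT.
case/and3P=> /and3P[nij nik nli] /andP[njk njl] nkl.
have graph_functionD2 U V : graph_function X (B + U + V) =
    graph_function X B * graph_function X U * graph_function X V.
  by rewrite 2!graph_functionD.
rewrite 3!graph_functionD2 !graph_function_segment //.
by rewrite -!mulrA -mulrDr (coord_plucker X ijkl) [X in _ * X]addrC.
Qed.

Lemma weighted_graph_sub_sym G H : weighted_graph G -> weighted_graph H ->
  (G - H)^T = G - H.
Proof. by move=> [Gs _ _] [Hs _ _]; apply/matrixP => a b; rewrite !mxE Gs Hs. Qed.

Lemma weighted_graph_sub_diag G H : weighted_graph G -> weighted_graph H ->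
  forall a, (G - H) a a = 0.
Proof. by move=> [_ Gd _] [_ Hd _] a; rewrite !mxE Gd Hd subrr. Qed.

(** The arcs with at most N vertices, each given by its start and its length. *)
Definition total_arc_form (D : 'M[int]_N) : int :=
  \sum_(p : 'I_N * 'I_N.+1) arc_form D p.1 (p.1 + p.2).

Lemma segment_row a b x : \sum_y segment a b x y = (x == a)%:R + (x == b)%:R.
Proof.
under eq_bigr do rewrite !mxE.
rewrite big_split /=; congr (_ + _).
  rewrite (bigD1 b) //= eqxx andbT big1 ?addr0 // => y /negPf yb.
  by rewrite yb andbF.
rewrite (bigD1 a) //= eqxx andbT big1 ?addr0 // => y /negPf yb.
by rewrite yb andbF.
Qed.

(** Induction on the sum of the form over all arcs, which each exchange
    decreases. *)
Lemma dominated_difference (X : a_space n) G1 G2 :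
    weighted_graph G1 -> weighted_graph G2 ->
    (forall a, \sum_b (G1 - G2) a b = 0) ->
    (forall x y, (x <= y <= x + N)%N -> 0 <= arc_form (G1 - G2) x y) ->
  Lplus (graph_function X G2 - graph_function X G1).
Proof.
have [m] := ubnP `|total_arc_form (G1 - G2)|%N.
elim: m G1 => // m IH G1; set D := G1 - G2; rewrite ltnS => Dm w1 w2 Drow D0.
have Ds := weighted_graph_sub_sym w1 w2; have Dd := weighted_graph_sub_diag w1 w2.
have arc_le (p : 'I_N * 'I_N.+1) : (p.1 <= p.1 + p.2 <= p.1 + N)%N.
  by rewrite leq_addr leq_add2l -ltnS ltn_ord.
have [/existsP[p pD]|/existsPn D_le0] :=
    boolP [exists p : 'I_N * 'I_N.+1, 0 < arc_form D p.1 (p.1 + p.2)]; last first.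
  have /eqP : D = 0.
    apply: arc_form_eq0 => // x y xy; have dN : (y - x < N.+1)%N by lia.
    apply/eqP; rewrite eq_le D0 // andbT.
    have := D_le0 (inord (x %% N), Ordinal dN); rewrite -leNgt /=.
    rewrite inordK ?ltn_mod // (@arc_form_modn _ _ _ x) ?modn_mod //.
    by rewrite subnKC //; lia.
  by rewrite subr_eq0 => /eqP->; rewrite subrr; apply: Lplus0.
have [i [j [k [l [[ij jk kl li] Djk Dil rect]]]]] :=
  exchange_exists Ds Dd Drow D0 (arc_le p) pD.
have ijkl := clockwise_vertex ij jk kl li.
have Uijkl : uniq [:: vertex n i; vertex n j; vertex n k; vertex n l].
  rewrite /= !inE !negb_or !andbT.
  by rewrite !vertex_neq //; lia.
have wB := weighted_graph_remove w1 w2 Uijkl Djk Dil.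
move: Uijkl (graph_function_plucker X
  (G1 - segment (vertex n i) (vertex n l) - segment (vertex n j) (vertex n k))
  ijkl Uijkl).
set B := _ - segment _ _ - _ in wB *; rewrite /= !inE !negb_or !andbT.
case/and3P=> /and3P[nij nik nli] /andP[njk njl] nkl plucker.
have EB : B + segment (vertex n i) (vertex n l)
            + segment (vertex n j) (vertex n k) = G1.
  by rewrite /B addrAC subrK subrK.
rewrite {}EB in plucker.
set G1' := B + segment _ _ + segment _ _ in plucker.
set G1'' := B + segment _ _ + segment _ _ in plucker.
have w1' : weighted_graph G1'.
  by do 2 (apply: weighted_graphD; last exact: weighted_graph_segment).
have w1'' : weighted_graph G1''.
  by do 2 (apply: weighted_graphD; last exact: weighted_graph_segment).
have D'E : G1' - G2 = D + segment (vertex n i) (vertex n k)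
    + segment (vertex n j) (vertex n l) - segment (vertex n i) (vertex n l)
    - segment (vertex n j) (vertex n k).
  by apply/matrixP => x y; rewrite /G1' /B /D !mxE; ring.
have arcs x y : (x <= y <= x + N)%N ->
    0 <= arc_form (G1' - G2) x y <= arc_form D x y.
  by move=> xy; rewrite D'E; apply: arc_form_exchange.
rewrite (_ : _ - _ = graph_function X G2 - graph_function X G1' +
                     graph_function X G1''); last by rewrite plucker; ring.
apply: LplusD; last exact: graph_function_Lplus.
apply: IH => // [|a|x y /arcs/andP[] //].
  apply: leq_trans Dm.
  have tot_ge0 : 0 <= total_arc_form (G1' - G2).
    by apply: sumr_ge0 => q _; have /andP[] := arcs _ _ (arc_le q).
  suff: total_arc_form (G1' - G2) < total_arc_form D.
    by move: tot_ge0; move: (total_arc_form _) (total_arc_form _) => t t'; lia.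
  have kjN : (k.+1 - j < N.+1)%N by lia.
  pose q : 'I_N * 'I_N.+1 := (inord (j %% N), Ordinal kjN).
  rewrite /total_arc_form [ltLHS](bigD1 q) // [ltRHS](bigD1 q) //=.
  apply: ltr_leD; last first.
    by apply: ler_sum => r _; have /andP[] := arcs _ _ (arc_le r).
  rewrite inordK ?ltn_mod // !(@arc_form_modn _ _ (j %% N) j) ?modn_mod //.
  by rewrite subnKC ?D'E; [apply: arc_form_exchange_lt | lia].
transitivity (\sum_b D a b + \sum_b segment (vertex n i) (vertex n k) a b
  + \sum_b segment (vertex n j) (vertex n l) a b
  - \sum_b segment (vertex n i) (vertex n l) a b
  - \sum_b segment (vertex n j) (vertex n k) a b); last first.
  by rewrite Drow !segment_row; ring.
rewrite -!big_split -!sumrB D'E /=; apply: eq_bigr => b _.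
by rewrite !mxE.
Qed.

Lemma arc_form_linear (D : 'M[int]_N) (k l : 'I_N) : (k <= l)%N ->
  arc_form D k l.+1 =
    \sum_(i < N | (k <= i <= l)%N) \sum_(j < N | (k <= j <= l)%N) D i j.
Proof.
move=> kl; rewrite exchange_big /arc_form /bform mxE [RHS]big_mkcond.
apply: eq_bigr => j _; rewrite !mxE arc_linear; last by have := ltn_ord l; lia.
rewrite ltnS; case: ifP => _; rewrite ?mulr0 // mulr1 [RHS]big_mkcond.
apply: eq_bigr => i _; rewrite arc_linear; last by have := ltn_ord l; lia.
by rewrite ltnS; case: ifP => _; rewrite ?mul0r ?mul1r.
Qed.

End WeightedGraphs.

Theorem theorem2p10 (n : nat) (hn : (1 <= n)%N) (X : a_space n)
    (G1 G2 : 'M[int]_n.+3)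
    (hG1 : weighted_graph G1) (hG2 : weighted_graph G2)
    (hGamma : forall k l : 'I_n.+3, (k <= l)%N -> Gamma k l G1 >= Gamma k l G2)
    (hR : forall p : 'I_n.+3, row_weight p G1 = row_weight p G2) :
  Lplus_le (graph_function X G1) (graph_function X G2).
Proof.
split; [exact: graph_function_Lplus | exact: graph_function_Lplus |].
have Drow a : \sum_b (G1 - G2) a b = 0.
  transitivity (row_weight a G1 - row_weight a G2); last by rewrite hR subrr.
  by rewrite /row_weight -sumrB; apply: eq_bigr => b _; rewrite !mxE.
apply: dominated_difference => //; apply: arc_form_ge0 => //.
  exact: weighted_graph_sub_sym.
move=> x [|y] /andP[xy yN].
  by move: xy; rewrite leqn0 => /eqP->; rewrite arc_form_nil.
move: xy; rewrite leq_eqVlt => /orP[/eqP->|xy]; first by rewrite arc_form_nil.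
have xN := leq_trans xy yN.
rewrite (@arc_form_linear _ _ (Ordinal xN) (Ordinal yN)) //.
have := hGamma (Ordinal xN) (Ordinal yN) xy.
rewrite /Gamma ler_pM2l ?invr_gt0 ?ltr0n // ler_int -subr_ge0 -sumrB.
congr (_ <= _); apply: eq_bigr => i _; rewrite -sumrB.
by apply: eq_bigr => j _; rewrite !mxE.
Qed.
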